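(* Every coherence space $A$ is a linear retract of the coherence space $\mathrm{flag}\,A$; that is, there exist linear morphisms $f_A: A\to \mathrm{flag}\,A$ and $t_A:\mathrm{flag}\,A\to A$ such that $t_A\circ f_A=\mathrm{Id}_A$ and $f_A\circ t_A\subset \mathrm{Id}_{\mathrm{flag}\,A}$ (inclusion of traces).
   Context: A coherence space $A$ is a set $|A|$ (its web, possibly infinite, whose elements are called tokens) endowed with a reflexive and symmetric binary relation on $|A|$, called coherence and written $\alpha\sim\alpha'\,[A]$. Strict coherence $\alpha\frown\alpha'\,[A]$ means $\alpha\sim\alpha'\,[A]$ and $\alpha\neq\alpha'$. A clique of $A$ is a set of pairwise coherent tokens. Linear morphisms from $A$ to $B$ are maps $F$ from cliques of $A$ to cliques of $B$ that are monotone for inclusion, commute with unions of families of pairwise compatible cliques (two cliques being compatible when their union is a clique), and satisfy $F(x\cap x')=F(x)\cap F(x')$ whenever $x\cup x'$ is a clique. They are in one-to-one correspondence with their traces $\{(\alpha,\beta)\mid \beta\in F(\{\alpha\})\}\subset|A|\times|B|$, which are exactly the cliques of the coherence space $A\multimap B$ with web $|A|\times|B|$ in which $(\alpha,\beta)\sim(\alpha',\beta')$ iff: ($\alpha\sim\alpha'\,[A]$ implies $\beta\sim\beta'\,[B]$) and ($\alpha\frown\alpha'\,[A]$ implies $\beta\frown\beta'\,[B]$). Composition of linear morphisms corresponds to relational composition of traces, and the identity $\mathrm{Id}_A$ has trace $\{(\alpha,\alpha)\mid\alpha\in|A|\}$. Linear morphisms are identified with their traces. Let $2^{\omega}$ be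 the set of infinite words on $\{0,1\}$, with the product topology (Cantor space) and the lexicographic total order: $w_1<w_2$ iff there are a finite word $m$ and infinite words $w_1',w_2'$ with $w_1=m0w_1'$ and $w_2=m1w_2'$. For a coherence space $A$, the coherence space $\mathrm{flag}\,A$ is defined as follows. Its web is the set of continuous functions from $2^\omega$ to $|A|$, where $|A|$ has the discrete topology. Two functions $f,g$ in this web are strictly coherent, $f\frown g\,[\mathrm{flag}\,A]$, iff there exists $w\in 2^\omega$ such that $f(w)\frown g(w)\,[A]$ and $f(w')=g(w')$ for all $w'<w$. *)

(* Defs.v *)
From mathcomp Require Import all_boot.
From mathcomp Require Import boolp classical_sets topology cantor.

Set Implicit Arguments.
Unset Strict Implicit.
Unset Printing Implicit Defensive.

Local Open Scope classical_set_scope.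

Record cohSpace := CohSpace {
  web :> Type ;
  coh : web -> web -> Prop ;
  coh_refl : forall a, coh a a ;
  coh_sym : forall a b, coh a b -> coh b a }.

Definition scoh (A : cohSpace) (a b : A) : Prop := coh a b /\ a <> b.

Definition is_clique (A : cohSpace) (x : set A) : Prop :=
  forall a b, x a -> x b -> coh a b.

Record clique (A : cohSpace) := Clique {
  tokens :> set A ;
  tokens_clique : is_clique tokens }.

Definition compatible (A : cohSpace) (x y : clique A) : Prop :=
  is_clique (tokens x `|` tokens y).

Definition pairwise_compatible (A : cohSpace) (X : set (clique A)) : Prop :=
  forall x y, X x -> X y -> compatible x y.

Lemma is_clique_bigcup (A : cohSpace) (X : set (clique A)) :
  pairwise_compatible X -> is_clique (\bigcup_(x in X) tokens x).
Proof.
by move=> cX a b [x Xx xa] [y Xy yb]; apply: (cX x y Xx Xy); [left|right].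
Qed.

Lemma is_cliqueI (A : cohSpace) (x y : clique A) :
  is_clique (tokens x `&` tokens y).
Proof. by move=> a b [xa _] [xb _]; exact: (tokens_clique (c := x)). Qed.

Lemma is_clique1 (A : cohSpace) (a : A) : is_clique [set a].
Proof. by move=> b c -> ->; exact: coh_refl. Qed.

Definition clique_bigcup (A : cohSpace) (X : set (clique A))
  (cX : pairwise_compatible X) : clique A := Clique (is_clique_bigcup cX).

Definition cliqueI (A : cohSpace) (x y : clique A) : clique A :=
  Clique (@is_cliqueI A x y).

Definition clique1 (A : cohSpace) (a : A) : clique A := Clique (@is_clique1 A a).

Lemma clique_ext (A : cohSpace) (x y : clique A) :
  tokens x = tokens y -> x = y.
Proof.
case: x y => [x cx] [y cy] /= exy; case: _ / exy in cy *.
by congr Clique; exact: Prop_irrelevance.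
Qed.

(* The family X below may be empty, so a linear morphism maps the empty clique
   to the empty clique. *)
Record linear_morphism (A B : cohSpace) := LinearMorphism {
  lin_fun :> clique A -> clique B ;
  lin_mono : forall x y : clique A,
    tokens x `<=` tokens y -> tokens (lin_fun x) `<=` tokens (lin_fun y) ;
  lin_bigcup : forall (X : set (clique A)) (cX : pairwise_compatible X),
    tokens (lin_fun (clique_bigcup cX)) = \bigcup_(x in X) tokens (lin_fun x) ;
  lin_meet : forall x y : clique A, compatible x y ->
    tokens (lin_fun (cliqueI x y)) = tokens (lin_fun x) `&` tokens (lin_fun y) }.

Lemma linear_ext (A B : cohSpace) (F G : linear_morphism A B) :
  (forall x, F x = G x) -> F = G.
Proof.
case: F G => [f f1 f2 f3] [g g1 g2 g3] /= /funext efg.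
case: _ / efg in g1 g2 g3 *.
by congr LinearMorphism; exact: Prop_irrelevance.
Qed.

Definition trace (A B : cohSpace) (F : linear_morphism A B) : set (A * B) :=
  [set p | tokens (F (clique1 p.1)) p.2].

Definition lin_id (A : cohSpace) : linear_morphism A A :=
  @LinearMorphism A A (fun x => x) (fun _ _ xy => xy)
    (fun _ _ => erefl) (fun _ _ _ => erefl).

Lemma lin_compatible (A B : cohSpace) (F : linear_morphism A B)
    (x y : clique A) : compatible x y -> compatible (F x) (F y).
Proof.
move=> cxy; pose u := Clique cxy.
have Fx : tokens (F x) `<=` tokens (F u) by apply: lin_mono => a; left.
have Fy : tokens (F y) `<=` tokens (F u) by apply: lin_mono => a; right.
by move=> a b [/Fx|/Fy] ? [/Fx|/Fy] ?; exact: (tokens_clique (c := F u)).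
Qed.

Section Composition.
Variables (A B C : cohSpace).
Variables (G : linear_morphism B C) (F : linear_morphism A B).

Let comp_mono (x y : clique A) :
  tokens x `<=` tokens y -> tokens (G (F x)) `<=` tokens (G (F y)).
Proof. by move=> xy; do 2!apply: lin_mono. Qed.

Let comp_bigcup (X : set (clique A)) (cX : pairwise_compatible X) :
  tokens (G (F (clique_bigcup cX))) = \bigcup_(x in X) tokens (G (F x)).
Proof.
have cFX : pairwise_compatible (lin_fun F @` X).
  by move=> _ _ [x Xx <-] [y Xy <-]; apply: lin_compatible; exact: cX.
have -> : F (clique_bigcup cX) = clique_bigcup cFX.
  by apply: clique_ext; rewrite lin_bigcup /= bigcup_image.
by rewrite lin_bigcup bigcup_image.
Qed.

Let comp_meet (x y : clique A) : compatible x y ->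
  tokens (G (F (cliqueI x y))) = tokens (G (F x)) `&` tokens (G (F y)).
Proof.
move=> cxy; rewrite -lin_meet; last exact: lin_compatible.
by congr (tokens (G _)); apply: clique_ext; rewrite lin_meet.
Qed.

Definition lin_comp : linear_morphism A C :=
  @LinearMorphism A C (fun x => G (F x)) comp_mono comp_bigcup comp_meet.

End Composition.

Definition word_cat (m : seq bool) (w : cantor_space) : cantor_space :=
  fun n => if (n < size m)%N then nth false m n else w (n - size m)%N.

(* The letters 0 and 1 are false and true: w1 = m 0 w1' and w2 = m 1 w2'. *)
Definition lex_lt (w1 w2 : cantor_space) : Prop :=
  exists (m : seq bool) (w1' w2' : cantor_space),
    w1 = word_cat (rcons m false) w1' /\ w2 = word_cat (rcons m true) w2'.

(* {classic A} is the type web A with the choice structure that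
   discrete_topology asks for. *)
Definition flag_web (A : cohSpace) : Type :=
  continuousType cantor_space (discrete_topology {classic (web A)}).

Definition flag_scoh (A : cohSpace) (f g : flag_web A) : Prop :=
  exists w : cantor_space, @scoh A (f w) (g w) /\
    forall w' : cantor_space, lex_lt w' w -> f w' = g w'.

Definition flag_coh (A : cohSpace) (f g : flag_web A) : Prop :=
  f = g \/ flag_scoh f g.

Lemma flag_coh_refl (A : cohSpace) (f : flag_web A) : flag_coh f f.
Proof. by left. Qed.

Lemma flag_coh_sym (A : cohSpace) (f g : flag_web A) :
  flag_coh f g -> flag_coh g f.
Proof.
case=> [->|[w [[c n] e]]]; first by left.
right; exists w; split; last by move=> w' /e ->.
by split; [exact: coh_sym | exact: nesym].
Qed.

Definition flag (A : cohSpace) : cohSpace :=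
  CohSpace (@flag_coh_refl A) (@flag_coh_sym A).

Lemma flag_scohE (A : cohSpace) (f g : flag A) : scoh f g <-> flag_scoh f g.
Proof.
split=> [[[efg /(_ efg)|//] //]|fgw].
split; first by right.
by move=> efg; case: fgw => w [[_]]; rewrite efg.
Qed.

(* Main.v *)
(** A token [a] of [A] is identified with the constant function [a]: the
    all-zero word being least in the lexicographic order, [a] and [b] are
    coherent in [A] iff the constant functions are coherent in [flag A].  The
    graph of this embedding is the trace of [f], and the converse relation is
    the trace of [t]. *)
Require Import Defs.
From mathcomp Require Import all_boot.
From mathcomp Require Import classical_sets.
From mathcomp Require Import boolp functions topology cantor.

Local Open Scope classical_set_scope.

Section LinearOfTrace.
Variables (A B : cohSpace) (r : A -> B -> Prop).
(* [r_coh] and [r_inj] together say that [r] is a clique of [A -o B]. *)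
Hypothesis r_coh : forall a a' b b',
  r a b -> r a' b' -> coh a a' -> coh b b'.
Hypothesis r_inj : forall a a' b, r a b -> r a' b -> coh a a' -> a = a'.

Definition trace_image (x : set A) : set B := [set b | exists2 a, x a & r a b].

Lemma trace_image_clique (x : clique A) : is_clique (trace_image x).
Proof.
move=> b b' [a xa rab] [a' xa' rab']; apply: (r_coh _ _ _ _ rab rab').
exact: tokens_clique xa xa'.
Qed.

Let F (x : clique A) : clique B := Clique (trace_image_clique x).

Let F_mono (x y : clique A) :
  tokens x `<=` tokens y -> tokens (F x) `<=` tokens (F y).
Proof. by move=> xy b [a /xy ya rab]; exists a. Qed.

Let F_bigcup (X : set (clique A)) (cX : pairwise_compatible X) :
  tokens (F (clique_bigcup cX)) = \bigcup_(x in X) tokens (F x).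
Proof.
apply/seteqP; split=> b.
  by move=> [a [x Xx xa] rab]; exists x => //; exists a.
by move=> [x Xx [a xa rab]]; exists a => //; exists x.
Qed.

Let F_meet (x y : clique A) : compatible x y ->
  tokens (F (cliqueI x y)) = tokens (F x) `&` tokens (F y).
Proof.
move=> cxy; apply/seteqP; split=> b.
  by move=> [a [xa ya] rab]; split; exists a.
move=> [[a xa rab] [a' ya' ra'b]]; exists a => //; split=> //.
(* Both [a] and [a'] lie in the union of [x] and [y], a clique by [cxy]; so they are coherent and
   [r_inj] identifies them. *)
by rewrite (r_inj _ _ _ rab ra'b) //; apply: cxy; [left | right].
Qed.

(** One direction of the trace correspondence: from a clique of [A -o B] to a linear morphism. *)
Definition linear_of_trace : linear_morphism A B :=
  @LinearMorphism A B F F_mono F_bigcup F_meet.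

End LinearOfTrace.

Lemma not_lex_lt_zero (w : cantor_space) : ~ lex_lt w (fun=> false).
Proof.
(* At position [size m] the larger word carries the letter 1, whereas the zero word carries 0. *)
move=> [m [w1 [w2 [_ /(congr1 (@^~ (size m)))]]]].
by rewrite /word_cat size_rcons ltnSn nth_rcons ltnn eqxx.
Qed.

Section ConstantFlag.
Variable A : cohSpace.

(** The type ascriptions let the continuity of [cst] be inferred for the discrete topology on the
    web. *)
Definition const_flag (a : A) : flag A :=
  (cst (a : discrete_topology {classic (web A)}) :
     continuousType cantor_space (discrete_topology {classic (web A)})).

Lemma const_flag_inj : injective const_flag.
Proof.
move=> a b /(congr1 (fun f : flag_web A => f (fun=> false))); exact.
Qed.

(** Any witness [w] of strict coherence compares [a] with [b] themselves. Conversely the zero word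
    is a witness: nothing precedes it, so the agreement condition is vacuous. *)
Lemma coh_const_flag (a b : A) : coh (const_flag a) (const_flag b) <-> coh a b.
Proof.
split=> [[/const_flag_inj ->|[w [[]]]] //|cab]; first exact: coh_refl.
have [->|nab] := EM (a = b); first exact: coh_refl.
right; exists (fun=> false); split=> [|w /not_lex_lt_zero //].
by split.
Qed.

End ConstantFlag.

Theorem proposition18 (A : cohSpace) :
  exists (f : linear_morphism A (flag A)) (t : linear_morphism (flag A) A),
    lin_comp t f = lin_id A /\
    trace (lin_comp f t) `<=` trace (lin_id (flag A)).
Proof.
pose r (a : A) (g : flag A) := g = const_flag A a.
have r_coh a a' g g' : r a g -> r a' g' -> coh a a' -> coh g g'.
  by move=> -> -> ?; apply/coh_const_flag.
have r_inj a a' g : r a g -> r a' g -> coh a a' -> a = a'.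
  by move=> -> /const_flag_inj.
have r'_coh g g' a a' : r a g -> r a' g' -> coh g g' -> coh a a'.
  by move=> -> -> /coh_const_flag.
have r'_inj g g' a : r a g -> r a g' -> coh g g' -> g = g' by move=> -> ->.
exists (linear_of_trace _ _ r r_coh r_inj).
exists (linear_of_trace _ _ (fun g a => r a g) r'_coh r'_inj); split.
  apply: linear_ext => x; apply: clique_ext; apply/seteqP; split=> a /=.
    by move=> [g [b xb ->] /const_flag_inj <-].
  by move=> xa; exists (const_flag A a) => //; exists a.
(* A pair [(g, h)] in this trace passes through some [a], which forces both [g] and [h] to be
   [const_flag A a]. *)
by move=> [g h] [a [_ -> /= ->] ->].
Qed.
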